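(* Let the second-order system $\Sigma$ satisfy the passivity condition $M>0$, $D>0$, $K>0$, $C_1=B^\top$, $C_0=0$. The reduced system $\widehat\Sigma_G$ is passive if $G^\top=H_1=C_1\Pi$ and $F_1,F_2>0$ satisfy $$(\Pi^\top M\Pi-F_2)S^2+(\Pi^\top D\Pi-F_1)S+\Pi^\top K\Pi>0.$$ Moreover, the reduced system $\widehat\Sigma_H$ is passive if $H_0=0$, $H_1=B^\top\Upsilon^\top$ and $F_1,F_2>0$ satisfy $$Q^2(\Upsilon M\Upsilon^\top-F_2)+Q(\Upsilon D\Upsilon^\top-F_1)+\Upsilon K\Upsilon^\top>0.$$
   Context: $\Sigma$ is the single-input single-output second-order system $M\ddot x+D\dot x+Kx=Bu$, $y=C_1\dot x+C_0x$, with $M,D,K\in\mathbb{R}^{n\times n}$, $B\in\mathbb{R}^{n}$, $C_0,C_1\in\mathbb{R}^{1\times n}$, and $\Omega=\{s\in\mathbb{C}:\det(Ms^2+Ds+K)=0\}$. $S,Q\in\mathbb{R}^{\nu\times\nu}$, $L\in\mathbb{R}^{1\times\nu}$, $R\in\mathbb{R}^\nu$ are such that $(L,S)$ is observable, $(Q,R)$ is controllable, $\sigma(S)\cap\Omega=\sigma(Q)\cap\Omega=\emptyset$; $\Pi\in\mathbb{R}^{n\times\nu}$ and $\Upsilon\in\mathbb{R}^{\nu\times n}$ are the unique solutions of $M\Pi S^2+D\Pi S+K\Pi=BL$ and $Q^2\Upsilon M+Q\Upsilon D+\Upsilon K=RC_0+QRC_1$, assumed to have full rank. $\widehat\Sigma_G$: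 $F_2\ddot\xi+F_1\dot\xi+(GL-F_2S^2-F_1S)\xi=Gu$, $\psi=H_1\dot\xi+(C_0\Pi+C_1\Pi S-H_1S)\xi$, with parameters $F_1,F_2\in\mathbb{R}^{\nu\times\nu}$, $G\in\mathbb{R}^\nu$, $H_1\in\mathbb{R}^{1\times\nu}$. $\widehat\Sigma_H$: $F_2\ddot\xi+F_1\dot\xi+(RH_0+QRH_1-Q^2F_2-QF_1)\xi=\Upsilon Bu$, $\psi=H_1\dot\xi+H_0\xi$, with parameters $F_1,F_2\in\mathbb{R}^{\nu\times\nu}$, $H_0,H_1\in\mathbb{R}^{1\times\nu}$. $X>0$ means that $X$ is real symmetric and positive definite. A system with input $u$ and output $\psi$ is passive if there is a nonnegative storage function $V$ of the state $(\xi,\dot\xi)$ with $V(t_1)-V(t_0)\le\int_{t_0}^{t_1}u(t)\psi(t)\,dt$ along all trajectories. *)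

(* Defs.v *)
From mathcomp Require Export all_boot all_order all_algebra.
From mathcomp Require Export all_classical all_reals all_analysis.
From mathcomp Require Export complex.

Set Implicit Arguments.
Unset Strict Implicit.
Unset Printing Implicit Defensive.

Import Order.TTheory GRing.Theory Num.Theory.
Import numFieldNormedType.Exports.

Local Open Scope classical_set_scope.
Local Open Scope ring_scope.

(* The single-input single-output system
     mass x'' + damping x' + stiffness x = input u,
     y = output_vel x' + output_pos x. *)
Record second_order_system (F : realType) (n : nat) := SecondOrderSystem {
  mass : 'M[F]_n;
  damping : 'M[F]_n;
  stiffness : 'M[F]_n;
  input : 'cV[F]_n;
  output_vel : 'rV[F]_n;
  output_pos : 'rV[F]_n }.

Definition posdef (F : realType) (n : nat) (X : 'M[F]_n) : Prop :=
  X^T = X /\ forall v : 'cV[F]_n, v != 0 -> 0 < (v^T *m X *m v) 0 0.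

Definition observable (F : realType) (m : nat) (L : 'rV[F]_m) (S : 'M[F]_m)
    : Prop :=
  \rank (\matrix_(i < m) (L *m S ^+ i)) = m.

Definition controllable (F : realType) (m : nat) (Q : 'M[F]_m) (R : 'cV[F]_m)
    : Prop :=
  \rank (\matrix_(i < m, j < m) (Q ^+ j *m R) i 0) = m.

Definition full_rank (F : realType) (m n : nat) (A : 'M[F]_(m, n)) : Prop :=
  \rank A = minn m n.

Definition complexify (F : realType) (m n : nat) (A : 'M[F]_(m, n))
    : 'M[F[i]]_(m, n) :=
  map_mx (real_complex F) A.

Definition spectrum (F : realType) (n : nat) (A : 'M[F]_n) : set F[i] :=
  [set s | eigenvalue (complexify A) s].

Definition Omega (F : realType) (n : nat) (M D K : 'M[F]_n) : set F[i] :=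
  [set s | \det (s ^+ 2 *: complexify M + s *: complexify D + complexify K)
           = 0].

Definition reduced_G (F : realType) (n nu : nat) (C0 C1 : 'rV[F]_n)
    (S : 'M[F]_nu) (L : 'rV[F]_nu) (Pi : 'M[F]_(n, nu))
    (F1 F2 : 'M[F]_nu) (G : 'cV[F]_nu) (H1 : 'rV[F]_nu)
    : second_order_system F nu :=
  {| mass := F2;
     damping := F1;
     stiffness := G *m L - F2 *m S ^+ 2 - F1 *m S;
     input := G;
     output_vel := H1;
     output_pos := C0 *m Pi + C1 *m Pi *m S - H1 *m S |}.

Definition reduced_H (F : realType) (n nu : nat) (B : 'cV[F]_n)
    (Q : 'M[F]_nu) (R : 'cV[F]_nu) (Ups : 'M[F]_(nu, n))
    (F1 F2 : 'M[F]_nu) (H0 H1 : 'rV[F]_nu)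
    : second_order_system F nu :=
  {| mass := F2;
     damping := F1;
     stiffness := R *m H0 + Q *m R *m H1 - Q ^+ 2 *m F2 - Q *m F1;
     input := Ups *m B;
     output_vel := H1;
     output_pos := H0 |}.

(* w is absolutely continuous on [t0, t1], with integrable derivative dw. *)
Definition integral_of (F : realType) (n : nat) (t0 t1 : F)
    (w dw : F -> 'cV[F]_n) : Prop :=
  forall i,
    lebesgue_measure.-integrable `[t0, t1] (fun t => (dw t i 0)%:E) /\
    forall t, t0 <= t <= t1 ->
      w t i 0 = w t0 i 0 + \int[lebesgue_measure]_(s in `[t0, t]) dw s i 0.

(* (x, v) is a state trajectory on [t0, t1], v standing for x', driven by the
   integrable input u. The equation of motion is understood in Caratheodory's
   sense: v is absolutely continuous and the equation holds at almost every
   time. Since v is continuous, x is then C^1 with derivative v. For continuous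
   u and C^2 x this is the ordinary notion of solution. *)
Definition trajectory (F : realType) (n : nat) (sys : second_order_system F n)
    (t0 t1 : F) (u : F -> F) (x v : F -> 'cV[F]_n) : Prop :=
  [/\ lebesgue_measure.-integrable `[t0, t1] (fun t => (u t)%:E),
      integral_of t0 t1 x v
    & exists2 a : F -> 'cV[F]_n, integral_of t0 t1 v a
      & {ae lebesgue_measure, forall t, t0 <= t <= t1 ->
           mass sys *m a t + damping sys *m v t + stiffness sys *m x t
           = u t *: input sys}].

Definition output (F : realType) (n : nat) (sys : second_order_system F n)
    (x v : F -> 'cV[F]_n) (t : F) : F :=
  (output_vel sys *m v t + output_pos sys *m x t) 0 0.

Definition passive (F : realType) (n : nat) (sys : second_order_system F n)
    : Prop :=
  exists V : 'cV[F]_n -> 'cV[F]_n -> F,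
    (forall x v, 0 <= V x v) /\
    forall (t0 t1 : F) (u : F -> F) (x v : F -> 'cV[F]_n),
      t0 <= t1 -> trajectory sys t0 t1 u x v ->
      V (x t1) (v t1) - V (x t0) (v t0)
        <= \int[lebesgue_measure]_(t in `[t0, t1]) (u t * output sys x v t).

(* Main.v *)
(* With G = Pi^T B (resp. input Ups B) the Sylvester-type equation for Pi
   (resp. Ups) turns the stiffness of the reduced system into the matrix assumed
   positive definite. A system with positive definite mass, damping and
   stiffness and output B^T v collocated with the input B u is passive, with
   storage function the energy (v^T M v + x^T K x)/2: its derivative is
   u y - v^T D v. Since velocities are only absolutely continuous, the energy
   balance needs the product rule for indefinite Lebesgue integrals, which
   follows from Fubini on the triangle {s <= t}. *)
From mathcomp Require Import measurable_realfun ring.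
Require Import Defs.
Import Order.TTheory GRing.Theory Num.Theory.
Import numFieldNormedType.Exports.
Local Open Scope classical_set_scope.
Local Open Scope ring_scope.

Section passivity.
Set Implicit Arguments.
Unset Strict Implicit.

Context (F : realType).
Notation mu := (@lebesgue_measure F).
Implicit Types (a b : F) (f g w z : F -> F).

(** * Fubini on a triangle *)

Lemma EFin_RintegralZl (D : set F) f c : measurable D ->
  mu.-integrable D (EFin \o f) ->
  (\int[mu]_(t in D) (c * f t)%:E = (c * \int[mu]_(t in D) f t)%:E)%E.
Proof.
move=> mD intf; under eq_integral do rewrite EFinM.
by rewrite integralZl// EFinM fineK//; exact: integrable_fin_num.
Qed.

(** By Tonelli: the inner integral of the absolute value is [|f s|] times the L1 norm of [g], so the
    iterated integral is the product of the two norms, which is finite. *)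
Lemma integrable_tensor f g :
  mu.-integrable setT (EFin \o f) -> mu.-integrable setT (EFin \o g) ->
  (mu \x mu)%E.-integrable setT (fun p => (f p.1 * g p.2)%:E).
Proof.
move=> intf intg.
have mf : measurable_fun setT f by move/measurable_EFinP: (measurable_int mu intf).
have mg : measurable_fun setT g by move/measurable_EFinP: (measurable_int mu intg).
apply/integrable12ltyP.
  apply/measurable_EFinP/measurable_funM.
    exact: (measurableT_comp mf measurable_fst).
  exact: (measurableT_comp mg measurable_snd).
have E s : (\int[mu]_t `|(f s * g t)%:E| = (`|f s| * \int[mu]_t `|g t|)%:E)%E.
  rewrite -EFin_RintegralZl//; last exact: integrable_norm.
  by apply: eq_integral => t _; rewrite /= normrM.
under eq_integral do rewrite E mulrC.
by rewrite EFin_RintegralZl ?ltry//; exact: integrable_norm.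
Qed.

(** Both sides are iterated integrals of [f s * g t] over the triangle [a <= s <= t <= b], taken in
    the two possible orders. *)
Lemma Rintegral_triangle_swap a b f g :
  mu.-integrable `[a, b] (EFin \o f) -> mu.-integrable `[a, b] (EFin \o g) ->
  \int[mu]_(t in `[a, b]) ((\int[mu]_(s in `[a, t]) f s) * g t) =
  \int[mu]_(s in `[a, b]) (f s * \int[mu]_(t in `[s, b]) g t).
Proof.
move=> intf intg.
(* Extension by zero, so that Fubini can be applied on the whole plane. *)
pose fJ := f \_ `[a, b]; pose gJ := g \_ `[a, b].
have intT (k : F -> F) : mu.-integrable `[a, b] (EFin \o k) ->
    mu.-integrable setT (EFin \o (k \_ `[a, b])).
  move=> ik; rewrite -restrict_EFin.
  by apply/integrable_restrict => //=; rewrite setTI.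
have intfg := integrable_tensor (intT _ intf) (intT _ intg).
(* The tensor product cut off outside the half-plane [s <= t]; the uncut product dominates it, which
   gives its integrability. *)
pose h (p : F * F) : F := if p.1 <= p.2 then fJ p.1 * gJ p.2 else 0.
have mh : measurable_fun [set: measurableTypeR F * measurableTypeR F] h.
  apply: measurable_fun_ifT => //; first exact: measurable_fun_ler.
  by move/measurable_EFinP: (measurable_int _ intfg).
have inth : (mu \x mu)%E.-integrable setT (EFin \o h).
  apply: le_integrable intfg => //; first exact/measurable_EFinP.
  by move=> p _; rewrite /= lee_fin /h; case: ifP; rewrite ?normr0.
have inI x y t : (t \in `[x, y]%classic) = (x <= t <= y).
  by apply/idP/idP; rewrite inE /= in_itv.
(* For [s] in [[a, b]] the section of the triangle is [[s, b]]; for other [s] both sides vanish.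
   [h2] treats the sections at fixed [t] in the same way. *)
have h1 s : (\int[mu]_t (h (s, t))%:E = (fJ s * \int[mu]_(t in `[s, b]) g t)%:E)%E.
  rewrite [in RHS]/fJ patchE inI; case: ifPn => [/andP[as_ sb]|sJ].
    rewrite -EFin_RintegralZl //; last first.
      by apply: integrableS intg => //; apply: subset_itvr; rewrite bnd_simp.
    rewrite [RHS]integral_mkcond; apply: eq_integral => t _.
    rewrite /h /fJ /gJ !patchE !inI /= as_ sb.
    case: (leP s t) => //= st; rewrite (le_trans as_ st) /=.
    by case: ifP => //; rewrite mulr0.
  rewrite mul0r; apply: integral0_eq => t _.
  by rewrite /h /fJ /= patchE inI (negbTE sJ) mul0r; case: ifP.
have h2 t : (\int[mu]_s (h (s, t))%:E = (\int[mu]_(s in `[a, t]) f s * gJ t)%:E)%E.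
  rewrite [in RHS]/gJ patchE inI mulrC; case: ifPn => [/andP[at_ tb]|tJ].
    rewrite -EFin_RintegralZl //; last first.
      by apply: integrableS intf => //; apply: subset_itvl; rewrite bnd_simp.
    rewrite [RHS]integral_mkcond; apply: eq_integral => s _.
    rewrite /h /fJ /gJ !patchE !inI /= at_ tb.
    case: (leP s t) => st /=; last by rewrite andbF.
    rewrite (le_trans st tb) !andbT mulrC.
    by case: ifP => //; rewrite mulr0.
  rewrite mul0r; apply: integral0_eq => s _.
  by rewrite /h /gJ /= patchE inI (negbTE tJ) mulr0; case: ifP.
have := Fubini inth.
under eq_integral do rewrite /= h1.
under [in RHS]eq_integral do rewrite /= h2.
move=> /(congr1 fine) E.
rewrite [LHS]Rintegral_mkcond [RHS]Rintegral_mkcond.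
transitivity (\int[mu]_s (fJ s * \int[mu]_(t in `[s, b]) g t)).
  rewrite [RHS]E; apply: eq_Rintegral => t _.
  by rewrite /gJ !patchE; case: ifP => //; rewrite mulr0.
by apply: eq_Rintegral => t _; rewrite /fJ !patchE; case: ifP => //; rewrite mul0r.
Qed.

(** * Calculus of indefinite Lebesgue integrals *)

(* The clause of [integral_of] for one component. *)
Definition primitive_on a b w dw : Prop :=
  mu.-integrable `[a, b] (EFin \o dw) /\
  forall t, a <= t <= b -> w t = w a + \int[mu]_(s in `[a, t]) dw s.

(** An indefinite integral is continuous, hence measurable, and bounded on the compact segment. This
    makes its product with any integrable function integrable. *)
Lemma primitive_on_bounded a b w dw : a <= b ->
  primitive_on a b w dw -> measurable_fun `[a, b] w /\ [bounded w x | x in `[a, b]].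
Proof.
move=> ab [iw wE].
have c := parameterized_integral_continuous ab iw.
have mI : measurable_fun `[a, b] (fun x => parameterized_integral mu a x dw).
  exact: subspace_continuous_measurable_fun.
split.
  apply: (eq_measurable_fun (fun t => w a + parameterized_integral mu a t dw)).
    by move=> t /set_mem /=; rewrite in_itv /= => /wE ->.
  exact: measurable_funD.
have /compact_bounded[N [Nr HN]] := continuous_compact c (@segment_compact _ a b).
exists (`|w a| + N); split; first by rewrite num_real.
move=> x xN t /=; rewrite in_itv/= => /[dup] tab /wE ->.
rewrite (le_trans (ler_normD _ _))// -lerBrDl; apply: HN; first by rewrite ltrBrDl.
by exists t => //=; rewrite in_itv/=.
Qed.

Lemma integrable_primitive_onM a b w dw f : a <= b -> primitive_on a b w dw ->
  mu.-integrable `[a, b] (EFin \o f) ->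
  mu.-integrable `[a, b] (EFin \o (w \* f)).
Proof.
move=> ab /(primitive_on_bounded ab)[mw bw] intf.
rewrite (_ : EFin \o _ = ((EFin \o w) \* (EFin \o f))%E); last first.
  by apply/funext => t; rewrite /= EFinM.
exact: integrableMr.
Qed.

Lemma primitive_on_itv a b t w dw :
  t <= b -> primitive_on a b w dw -> primitive_on a t w dw.
Proof.
move=> tb [iw wE]; split.
  by apply: integrableS iw => //; apply: subset_itvl; rewrite bnd_simp.
by move=> s /andP[as_ st]; apply: wE; rewrite as_ (le_trans st tb).
Qed.

Lemma Rintegral_primitive_on a b w dw s : primitive_on a b w dw ->
  a <= s <= b -> \int[mu]_(t in `[s, b]) dw t = w b - w s.
Proof.
move=> [iw wE] /andP[as_ sb]; have ab := le_trans as_ sb.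
rewrite (wE s) ?as_// (wE b) ?ab ?lexx// opprD addrACA subrr add0r.
rewrite Rintegral_itvB ?bnd_simp// Rintegral_itv_obnd_cbnd//.
by apply: integrableS iw => //; apply: subset_itvr; rewrite bnd_simp.
Qed.

Lemma primitive_onZ a b c w dw : primitive_on a b w dw ->
  primitive_on a b (fun t => w t * c) (fun t => dw t * c).
Proof.
move=> [iw wE]; split.
  rewrite (_ : EFin \o _ = ((EFin \o dw) \* cst c%:E)%E); first exact: integrableZr.
  by apply/funext => t; rewrite /= EFinM.
move=> t /[dup] tab /andP[at_ tb]; rewrite wE// mulrDl RintegralZr//.
by apply: integrableS iw => //; apply: subset_itvl; rewrite bnd_simp.
Qed.

Lemma primitive_onD a b w dw z dz :
  primitive_on a b w dw -> primitive_on a b z dz ->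
  primitive_on a b (fun t => w t + z t) (fun t => dw t + dz t).
Proof.
move=> [iw wE] [iz zE]; split.
  rewrite (_ : EFin \o _ = ((EFin \o dw) \+ (EFin \o dz))%E); first exact: integrableD.
  by apply/funext => t; rewrite /= EFinD.
move=> t /[dup] tab /andP[at_ tb]; rewrite wE// zE// addrACA RintegralD//.
  by apply: integrableS iw => //; apply: subset_itvl; rewrite bnd_simp.
by apply: integrableS iz => //; apply: subset_itvl; rewrite bnd_simp.
Qed.

Lemma primitive_on_sum (I : Type) (r : seq I) a b (w dw : I -> F -> F) :
  (forall i, primitive_on a b (w i) (dw i)) ->
  primitive_on a b (fun t => \sum_(i <- r) w i t) (fun t => \sum_(i <- r) dw i t).
Proof.
move=> pw; elim: r => [|i r IH].
  have nil (f : I -> F -> F) : (fun t => \sum_(j <- [::]) f j t) = cst 0.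
    by apply/funext => t; rewrite big_nil.
  rewrite !nil.
  split; first exact: (@integrable0 _ _ _ mu).
  by move=> t _; rewrite /= Rintegral_cst ?mul0r ?addr0.
have cons (f : I -> F -> F) : (fun t => \sum_(j <- i :: r) f j t) =
    (fun t => f i t + \sum_(j <- r) f j t).
  by apply/funext => t; rewrite big_cons.
by rewrite !cons; exact: primitive_onD.
Qed.

(** Integration by parts: the double integral obtained by expanding [w] inside the integral of
    [w * dz] is swapped over the triangle, after which the integral of [dw * z] cancels. *)
Lemma primitive_onM a b w dw z dz : a <= b ->
  primitive_on a b w dw -> primitive_on a b z dz ->
  primitive_on a b (fun t => w t * z t) (fun t => dw t * z t + w t * dz t).
Proof.
move=> ab pw pz.
have int x y : x <= y -> primitive_on x y w dw -> primitive_on x y z dz ->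
    mu.-integrable `[x, y] (EFin \o (fun t => dw t * z t)) /\
    mu.-integrable `[x, y] (EFin \o (fun t => w t * dz t)).
  move=> xy qw qz; split; last by apply: integrable_primitive_onM qw (qz.1).
  rewrite (_ : (fun t => _) = z \* dw); last by apply/funext => t; rewrite /= mulrC.
  by apply: integrable_primitive_onM qz (qw.1).
split.
  rewrite (_ : EFin \o _ = ((EFin \o (fun t => dw t * z t)%R) \+
      (EFin \o (fun t => w t * dz t)%R))%E); last by apply/funext => t; rewrite /= EFinD.
  by have [] := int _ _ ab pw pz; exact: integrableD.
move=> t /andP[at_ tb].
move: pw pz => /(primitive_on_itv tb) pw /(primitive_on_itv tb) pz.
have [i1 i2] := int _ _ at_ pw pz.
rewrite RintegralD//.
have itvE s : s \in `[a, t]%classic -> a <= s <= t by rewrite inE /= in_itv.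
(* The part of [w] that vanishes at [a] is itself a primitive of [dw], so its product with [dz] is
   integrable. *)
have pW : primitive_on a t (fun s => \int[mu]_(r in `[a, s]) dw r) dw.
  by split=> [|s _]; [exact: pw.1|rewrite set_itv1 Rintegral_set1 add0r].
have iz1 : mu.-integrable `[a, t] (EFin \o (fun s => w a * dz s)).
  rewrite (_ : (fun s => _) = fun s => dz s * w a).
    exact: (primitive_onZ (w a) pz).1.
  by apply/funext => s; rewrite mulrC.
have -> : \int[mu]_(s in `[a, t]) (w s * dz s) =
    w a * (z t - z a) + \int[mu]_(s in `[a, t]) (dw s * (z t - z s)).
  transitivity (\int[mu]_(s in `[a, t])
      (w a * dz s + (\int[mu]_(r in `[a, s]) dw r) * dz s)).
    by apply: eq_Rintegral => s /itvE sat; rewrite -mulrDl -pw.2.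
  rewrite RintegralD ?RintegralZl//; last 2 first.
  - exact: pz.1.
  - exact: integrable_primitive_onM pW (pz.1).
  rewrite Rintegral_triangle_swap ?pw.1 ?pz.1//.
  rewrite (Rintegral_primitive_on pz) ?lexx//; congr (_ + _).
  by apply: eq_Rintegral => s /itvE sat; rewrite (Rintegral_primitive_on pz).
(* The subtracted integral cancels the first half of the product rule; only boundary terms are left
   for [ring]. *)
have -> : \int[mu]_(s in `[a, t]) (dw s * (z t - z s)) =
    (w t - w a) * z t - \int[mu]_(s in `[a, t]) (dw s * z s).
  under eq_Rintegral do rewrite mulrBr.
  rewrite RintegralB ?RintegralZr//; [|exact: pw.1|exact: (primitive_onZ _ pw).1].
  by rewrite (Rintegral_primitive_on pw) ?lexx.
ring.
Qed.

(** Removing a null set that contains all exceptional points changes neither integral. The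
    almost-everywhere form is needed because the equation of motion holds only at almost every
    time. *)
Lemma le_Rintegral_ae (D : set F) f g : measurable D ->
  mu.-integrable D (EFin \o f) -> mu.-integrable D (EFin \o g) ->
  {ae mu, forall x, D x -> f x <= g x} ->
  \int[mu]_(x in D) f x <= \int[mu]_(x in D) g x.
Proof.
move=> mD iF iG [N [mN N0 subN]].
rewrite /Rintegral (negligible_integral mN mD iF N0) (negligible_integral mN mD iG N0).
apply: le_Rintegral.
- exact: measurableD.
- by apply: integrableS iF => //; exact: measurableD.
- by apply: integrableS iG => //; exact: measurableD.
move=> x [Dx Nx]; apply: contra_notT Nx => nfg; apply: subN => /=.
by move=> /(_ Dx); rewrite (negbTE nfg).
Qed.

(** * Matrix algebra and bilinear forms along trajectories *)

Lemma subrDsubrD (V : zmodType) (x y z a b : V) :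
  (x - a) + (y - b) + z = x + y + z - a - b.
Proof. by rewrite addrACA -opprD [LHS]addrAC opprD addrA. Qed.

Lemma posdef_ge0 (m : nat) (A : 'M[F]_m) (v : 'cV[F]_m) :
  posdef A -> 0 <= (v^T *m A *m v) 0 0.
Proof.
move=> [_ Apos]; have [->|/Apos/ltW//] := eqVneq v 0.
by rewrite mulmx0 mxE.
Qed.

Lemma bilinear_sym (m : nat) (A : 'M[F]_m) (v w : 'cV[F]_m) :
  A^T = A -> (v^T *m A *m w) 0 0 = (w^T *m A *m v) 0 0.
Proof.
move=> As; transitivity ((w^T *m A *m v)^T 0 0); last by rewrite mxE.
by rewrite !trmx_mul As trmxK mulmxA.
Qed.

(** In coordinates the form is a finite sum of products of scalar primitives, so the scalar product
    rule applies termwise. *)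
Lemma primitive_on_bilinear (m : nat) (A : 'M[F]_m) (a b : F)
    (w dw z dz : F -> 'cV[F]_m) : a <= b ->
  integral_of a b w dw -> integral_of a b z dz ->
  primitive_on a b (fun t => ((w t)^T *m A *m z t) 0 0)
    (fun t => ((dw t)^T *m A *m z t) 0 0 + ((w t)^T *m A *m dz t) 0 0).
Proof.
move=> ab pw pz.
have E (f g : F -> 'cV[F]_m) : (fun t => ((f t)^T *m A *m g t) 0 0) =
    (fun t => \sum_j (\sum_i f t i 0 * A i j) * g t j 0).
  apply/funext => t; rewrite mxE; apply: eq_bigr => j _; rewrite mxE; congr (_ * _).
  by apply: eq_bigr => i _; rewrite mxE.
rewrite E (_ : (fun t => _ + _) = (fun t =>
  \sum_j ((\sum_i dw t i 0 * A i j) * z t j 0 + (\sum_i w t i 0 * A i j) * dz t j 0))).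
  apply: primitive_on_sum => j; apply: primitive_onM => //; last exact: pz.
  by apply: primitive_on_sum => i; apply: primitive_onZ; exact: pw.
apply/funext => t; rewrite big_split /=.
by congr (_ + _); [exact: (congr1 (@^~ t) (E dw z))|exact: (congr1 (@^~ t) (E w dz))].
Qed.

Lemma primitive_on_linear (m : nat) (h : 'rV[F]_m) (a b : F)
    (w dw : F -> 'cV[F]_m) : integral_of a b w dw ->
  primitive_on a b (fun t => (h *m w t) 0 0) (fun t => (h *m dw t) 0 0).
Proof.
move=> pw.
have E (f : F -> 'cV[F]_m) : (fun t => (h *m f t) 0 0) =
    (fun t => \sum_j f t j 0 * h 0 j).
  by apply/funext => t; rewrite mxE; apply: eq_bigr => j _; rewrite mulrC.
rewrite !E; apply: primitive_on_sum => j; apply: primitive_onZ; exact: pw.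
Qed.

(** * Energy balance and passivity *)

Lemma posdef_passive (m : nat) (sys : second_order_system F m) :
  posdef (mass sys) -> posdef (damping sys) -> posdef (stiffness sys) ->
  output_vel sys = (input sys)^T -> output_pos sys = 0 -> passive sys.
Proof.
move=> posM posD posK Hv Hp.
pose V (x v : 'cV[F]_m) :=
  ((v^T *m mass sys *m v) 0 0 + (x^T *m stiffness sys *m x) 0 0) * 2^-1.
exists V; split=> [x v|t0 t1 u x v t01 [iu px [a pv ode]]].
  by rewrite mulr_ge0 ?addr_ge0 ?posdef_ge0 ?invr_ge0.
have := primitive_onZ 2^-1 (primitive_onD
  (primitive_on_bilinear (mass sys) t01 pv pv)
  (primitive_on_bilinear (stiffness sys) t01 px px)).
(* [p] is the power, the derivative of the energy along the trajectory; it remains to bound it by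
   the supply rate almost everywhere. *)
set p := (X in primitive_on _ _ _ X) => pV.
have outE t : output sys x v t = (output_vel sys *m v t) 0 0.
  by rewrite /output Hp mul0mx addr0.
have -> : V (x t1) (v t1) - V (x t0) (v t0) = \int[mu]_(t in `[t0, t1]) p t.
  by rewrite (Rintegral_primitive_on pV) ?lexx.
apply: le_Rintegral_ae => //.
- exact: pV.1.
- rewrite (_ : (fun t => _) = (fun t => (output_vel sys *m v t) 0 0) \* u).
    exact: integrable_primitive_onM (primitive_on_linear _ pv) iu.
  by apply/funext => t; rewrite /= outE mulrC.
move: ode; apply: filterS; first exact: (ae_filter_ringOfSetsType mu).
move=> t ode; rewrite /= in_itv /= => /ode {}ode.
(* Symmetry of mass and stiffness makes the two terms from each product rule equal, which absorbs
   the factor one half. *)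
have -> : p t = ((v t)^T *m (mass sys *m a t + stiffness sys *m x t)) 0 0.
  rewrite /p (bilinear_sym (a t) (v t) posM.1) (bilinear_sym (x t) (v t) posK.1).
  by rewrite mulmxDr !mulmxA [in RHS]mxE; field.
have -> : mass sys *m a t + stiffness sys *m x t =
    u t *: input sys - damping sys *m v t.
  by rewrite -ode addrAC addrK.
rewrite outE Hv mulmxBr -scalemxAr mulmxA mxE [X in X + _ <= _]mxE [X in _ + X <= _]mxE.
have -> : ((v t)^T *m input sys) 0 0 = ((input sys)^T *m v t) 0 0.
  by rewrite -[in LHS](trmxK (input sys)) -trmx_mul mxE.
(* The gap between supply and power is the dissipation [v^T D v]. *)
by rewrite gerBl posdef_ge0.
Qed.

End passivity.

(** * The two reduced systems *)

Theorem proposition5 (F : realType) (n nu : nat)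
    (M D K : 'M[F]_n) (B : 'cV[F]_n) (C0 C1 : 'rV[F]_n)
    (S Q : 'M[F]_nu) (L : 'rV[F]_nu) (R : 'cV[F]_nu)
    (Pi : 'M[F]_(n, nu)) (Ups : 'M[F]_(nu, n))
    (obsLS : observable L S) (ctrQR : controllable Q R)
    (specS : spectrum S `&` Omega M D K = set0)
    (specQ : spectrum Q `&` Omega M D K = set0)
    (eqPi : M *m Pi *m S ^+ 2 + D *m Pi *m S + K *m Pi = B *m L)
    (eqUps : Q ^+ 2 *m Ups *m M + Q *m Ups *m D + Ups *m K
             = R *m C0 + Q *m R *m C1)
    (rkPi : full_rank Pi) (rkUps : full_rank Ups)
    (posM : posdef M) (posD : posdef D) (posK : posdef K)
    (eqC1 : C1 = B^T) (eqC0 : C0 = 0) :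
  (forall (F1 F2 : 'M[F]_nu) (G : 'cV[F]_nu) (H1 : 'rV[F]_nu),
     G^T = H1 -> H1 = C1 *m Pi -> posdef F1 -> posdef F2 ->
     posdef ((Pi^T *m M *m Pi - F2) *m S ^+ 2
             + (Pi^T *m D *m Pi - F1) *m S + Pi^T *m K *m Pi) ->
     passive (reduced_G C0 C1 S L Pi F1 F2 G H1))
  /\
  (forall (F1 F2 : 'M[F]_nu) (H0 H1 : 'rV[F]_nu),
     H0 = 0 -> H1 = B^T *m Ups^T -> posdef F1 -> posdef F2 ->
     posdef (Q ^+ 2 *m (Ups *m M *m Ups^T - F2)
             + Q *m (Ups *m D *m Ups^T - F1) + Ups *m K *m Ups^T) ->
     passive (reduced_H B Q R Ups F1 F2 H0 H1)).
Proof.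
move: eqUps eqPi; rewrite {C0}eqC0 {C1}eqC1 => eqUps eqPi; split.
- move=> F1 F2 G _ <- GPi posF1 posF2 posStiff; apply: posdef_passive => //=.
  + suff <- : (Pi^T *m M *m Pi - F2) *m S ^+ 2 + (Pi^T *m D *m Pi - F1) *m S
        + Pi^T *m K *m Pi = G *m L - F2 *m S ^+ 2 - F1 *m S by [].
    (* Since [G = Pi^T B], this is the equation for [Pi] multiplied on the left by [Pi^T]. *)
    have -> : G *m L = Pi^T *m (M *m Pi *m S ^+ 2 + D *m Pi *m S + K *m Pi).
      by rewrite eqPi -(trmxK G) GPi trmx_mul trmxK mulmxA.
    by rewrite !mulmxBl !mulmxDr !mulmxA subrDsubrD.
  (* The position output vanishes because [C0 = 0] and [H1 = C1 Pi]. *)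
  + by rewrite GPi mul0mx add0r subrr.
- move=> F1 F2 _ _ -> -> posF1 posF2 posStiff; apply: posdef_passive => //=.
  + suff <- : Q ^+ 2 *m (Ups *m M *m Ups^T - F2)
        + Q *m (Ups *m D *m Ups^T - F1) + Ups *m K *m Ups^T
      = R *m 0 + Q *m R *m (B^T *m Ups^T) - Q ^+ 2 *m F2 - Q *m F1 by [].
    (* Dually, the equation for [Ups] is multiplied on the right by [Ups^T]. *)
    have -> : R *m 0 + Q *m R *m (B^T *m Ups^T)
        = (Q ^+ 2 *m Ups *m M + Q *m Ups *m D + Ups *m K) *m Ups^T.
      by rewrite eqUps !mulmx0 !add0r mulmxA.
    by rewrite !mulmxBr !mulmxDl !mulmxA subrDsubrD.
  + by rewrite trmx_mul.
Qed.
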